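(* Let $m,n\geq 3$ be integers. Then $\gamma^{\mathrm{ID}}_{D,\infty}(\mathcal P_{m,n})=m+n-2$.
   Context: For integers $m,n\geq1$, $\mathcal P_{m,n}$ denotes the set of points $(x,y)\in\mathbb Z^2$ with $1\leq y\leq m$ and $1\leq x\leq n$. A point is covered by a set $H\subseteq\mathbb R^2$ if it belongs to $H$; two points are separated by $H$ if exactly one of them belongs to $H$. A family of sets identifies a finite set $\mathcal P\subseteq\mathbb R^2$ if every point of $\mathcal P$ is covered by some member of the family and every pair of distinct points of $\mathcal P$ is separated by some member. $\gamma^{\mathrm{ID}}_{D,\infty}(\mathcal P)$ denotes the minimum number of (closed) half-planes in a family of half-planes identifying $\mathcal P$ (identification by disks of infinite radius). *)

(* Defs.v *)
From HB Require Import structures.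
From mathcomp Require Import all_boot all_order all_algebra.
From mathcomp Require Import boolp classical_sets reals.

Set Implicit Arguments.
Unset Strict Implicit.
Unset Printing Implicit Defensive.

Import Order.TTheory GRing.Theory Num.Theory.
Local Open Scope classical_set_scope.
Local Open Scope ring_scope.

Definition closed_half_plane (R : realType) (H : set (R * R)) : Prop :=
  exists a b c : R,
    (a, b) <> (0, 0) /\ H = [set p | a * p.1 + b * p.2 <= c].

Definition separates (R : realType) (H : set (R * R)) (p q : R * R) : Prop :=
  (H p /\ ~ H q) \/ (~ H p /\ H q).

Definition identifies (R : realType) (k : nat) (F : 'I_k -> set (R * R))
    (P : set (R * R)) : Prop :=
  (forall p, P p -> exists i, F i p) /\
  (forall p q, P p -> P q -> p <> q -> exists i, separates (F i) p q).

Definition half_plane_identifiable (R : realType) (P : set (R * R)) (k : nat) :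
    Prop :=
  exists F : 'I_k -> set (R * R),
    (forall i, closed_half_plane (F i)) /\ identifies F P.

(* The identification number is given by its graph, [k] being the minimum:
   no default value is needed for a [P] that no finite family identifies.
   Families may repeat a half-plane; this does not affect the minimum. *)
Definition is_half_plane_id_number (R : realType) (P : set (R * R)) (k : nat) :
    Prop :=
  half_plane_identifiable P k /\
  (forall l : nat, half_plane_identifiable P l -> (k <= l)%N).

(* [m] bounds the ordinate and [n] the abscissa: [m] rows and [n] columns. *)
Definition grid (R : realType) (m n : nat) : set (R * R) :=
  [set p | exists x y : int,
     [/\ p = (x%:~R, y%:~R), 1 <= y <= m%:Z & 1 <= x <= n%:Z]].

Arguments grid : clear implicits.

(* Main.v *)
Require Import Defs.
From HB Require Import structures.
From mathcomp Require Import all_boot all_order all_algebra.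
From mathcomp Require Import boolp classical_sets reals.
From mathcomp Require Import zify lra.

(** Lower bound: the perimeter of the grid is a cycle of 2(m+n-2) unit edges,
    each of which must be cut by some half-plane of the family.  A half-plane
    cuts at most two of them: along a side of the rectangle membership is
    monotone, so a side is cut once if its two corners are separated and never
    otherwise, and the four corners cannot alternate around the rectangle since
    both diagonals have the same midpoint.
    Upper bound: m-1 horizontal and n-1 vertical lines separate all pairs; since
    there are at least two vertical lines, the first two half-planes can be
    turned towards each other so that together they cover the plane. *)

Set Implicit Arguments.
Unset Strict Implicit.
Unset Printing Implicit Defensive.

Import Order.TTheory GRing.Theory Num.Theory.
Local Open Scope ring_scope.

Definition lattice_point (R : realType) (x y : nat) : R * R := (x%:R, y%:R).
Arguments lattice_point : clear implicits.

(** Grid coordinates are positive, so the counting can be done over [nat]. *)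
Lemma gridP (R : realType) (m n : nat) (p : R * R) :
  grid R m n p <-> exists x y : nat,
    [/\ p = lattice_point R x y, (1 <= y <= m)%N & (1 <= x <= n)%N].
Proof.
split=> [[[x|x] [[y|y] [-> hy hx]]]|[x [y [-> hy hx]]]]; try by lia.
- by exists x, y; split=> //; lia.
- by exists x%:Z, y%:Z; split=> //; lia.
Qed.

Lemma separatesC (R : realType) (H : set (R * R)) (p q : R * R) :
  separates H p q -> separates H q p.
Proof. by case=> [[? ?]|[? ?]]; [right|left]. Qed.

Lemma separates_asbool (R : realType) (H : set (R * R)) (p q : R * R) :
  separates H p q -> `[< H p >] != `[< H q >].
Proof.
by case=> [[hp hq]|[hp hq]]; [rewrite asboolT // asboolF|rewrite asboolF // asboolT].
Qed.

Lemma sum_affine_changes (R : realType) (u v c : R) (N : nat) :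
  (\sum_(i < N) ((u * i%:R + v <= c)%R != (u * i.+1%:R + v <= c)%R) =
   ((v <= c)%R != (u * N%:R + v <= c)%R))%N.
Proof.
elim: N => [|N IH]; first by rewrite big_ord0 mulr0 add0r eqxx.
rewrite big_ord_recr /= {}IH -natr1 mulrDr mulr1.
have N0 : 0 <= N%:R :> R by [].
(* The only case at issue has the value at [N] on the other side of [c] from the values at [0] and
   [N.+1]. Then [u * N%:R] and [u] have strictly opposite signs, against [N0]. *)
move: (lerP v c) (lerP (u * N%:R + v) c) (lerP (u * N%:R + u + v) c).
by case=> h1; case=> h2; case=> h3 //=; exfalso; nra.
Qed.

(** [M] and [N] count the unit edges of a side, one less than its points. *)
Definition perimeter_cuts (R : realType) (M N : nat) (H : set (R * R)) : nat :=
  let cut x y x' y' : nat :=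
    `[< H (lattice_point R x y) >] != `[< H (lattice_point R x' y') >] in
  (\sum_(i < N) cut i.+1 1 i.+2 1 + \sum_(i < N) cut i.+1 M.+1 i.+2 M.+1 +
   (\sum_(j < M) cut 1 j.+1 1 j.+2 + \sum_(j < M) cut N.+1 j.+1 N.+1 j.+2))%N.

Lemma half_plane_perimeter_cuts (R : realType) (M N : nat) (H : set (R * R)) :
  closed_half_plane H -> (perimeter_cuts M N H <= 2)%N.
Proof.
case=> a [b [c [_ ->]]]; rewrite /perimeter_cuts /lattice_point /=.
have row y : (\sum_(i < N) (`[< (a * i.+1%:R + b * y <= c)%R >] !=
                          `[< (a * i.+2%:R + b * y <= c)%R >]) =
    ((a + b * y <= c)%R != (a * N%:R + (a + b * y) <= c)%R))%N.
  rewrite -sum_affine_changes; apply: eq_bigr => i _; rewrite !asboolb.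
  have e (z : R) : a * (z + 1) + b * y = a * z + (a + b * y) by lra.
  by rewrite -!e !natr1.
have col x : (\sum_(i < M) (`[< (a * x + b * i.+1%:R <= c)%R >] !=
                          `[< (a * x + b * i.+2%:R <= c)%R >]) =
    ((a * x + b <= c)%R != (b * M%:R + (a * x + b) <= c)%R))%N.
  rewrite -sum_affine_changes; apply: eq_bigr => i _; rewrite !asboolb.
  have e (z : R) : a * x + b * (z + 1) = b * z + (a * x + b) by lra.
  by rewrite -!e !natr1.
rewrite !row !col -!natr1; set s := N%:R; set t := M%:R.
(* Each corner lies on a row and on a column; both expressions of its value are brought to one form,
   so that a single case split decides both. *)
rewrite !mulrDr !mulr1 !mulr0 !add0r -addrA.
rewrite (addrCA (b * t) a) (addrCA (b * t)) (addrCA (b * t) a).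
(* The number of changes around the four corners is even. It is 4 only if one diagonal is inside and
   the other outside, but opposite corner values have equal sums. *)
case: (lerP (a + b) c) => h1; case: (lerP (a * s + (a + b)) c) => h2;
case: (lerP (a + (b * t + b)) c) => h3;
case: (lerP (a * s + (a + (b * t + b))) c) => h4 //=; exfalso; lra.
Qed.

(** Double counting: after exchanging the sums, each edge contributes at least 1, since its
    endpoints are distinct grid points. *)
Lemma identifies_perimeter_cuts (R : realType) (M N l : nat)
    (F : 'I_l -> set (R * R)) :
  identifies F (grid R M.+1 N.+1) ->
  (N + N + (M + M) <= \sum_(k < l) perimeter_cuts M N (F k))%N.
Proof.
case=> _ sepF; rewrite /perimeter_cuts !big_split /=.
have edge (x y x' y' : nat) : (1 <= x <= N.+1)%N -> (1 <= y <= M.+1)%N ->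
    (1 <= x' <= N.+1)%N -> (1 <= y' <= M.+1)%N -> (x != x') || (y != y') ->
    (1 <= \sum_(k < l) (`[< F k (lattice_point R x y) >] !=
                        `[< F k (lattice_point R x' y') >]))%N.
  move=> hx hy hx' hy' ne.
  have [||e|k /separates_asbool hk] :=
      sepF (lattice_point R x y) (lattice_point R x' y').
  - by apply/gridP; exists x, y.
  - by apply/gridP; exists x', y'.
  - case: e => /eqP; rewrite eqr_nat => /eqP ex /eqP; rewrite eqr_nat => /eqP ey.
    by rewrite ex ey !eqxx in ne.
  - by rewrite (bigD1 k) //= hk.
have side K (f : 'I_K -> 'I_l -> nat) :
    (forall i, 1 <= \sum_(k < l) f i k)%N ->
    (K <= \sum_(k < l) \sum_(i < K) f i k)%N.
  move=> hf; rewrite exchange_big /= -[K in (K <= _)%N]card_ord -sum1_card.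
  exact: leq_sum.
by do !apply: leq_add; apply: side => i; apply: edge; have := ltn_ord i; lia.
Qed.

Lemma grid_identification_lower_bound (R : realType) (M N l : nat) :
  half_plane_identifiable (grid R M.+1 N.+1) l -> (M + N <= l)%N.
Proof.
case=> F [hF /identifies_perimeter_cuts cuts].
have : (\sum_(k < l) perimeter_cuts M N (F k) <= \sum_(k < l) 2)%N.
  by apply: leq_sum => k _; exact: half_plane_perimeter_cuts.
by rewrite sum_nat_const card_ord; lia.
Qed.

Lemma grid_half_plane_identifiable (R : realType) (M N : nat) :
  (2 <= N)%N -> half_plane_identifiable (grid R M.+1 N.+1) (N + M).
Proof.
move=> N2.
(* A triple [(a, b, c)] stands for [a * x + b * y <= c]. Index 0 is [x >= 2], the indices below [N]
   are vertical cuts, the others horizontal. *)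
pose coef i : R * R * R :=
  if i == 0 then (-1, 0, -2)
  else if (i < N)%N then (1, 0, i.+1%:R) else (0, 1, (i - N).+1%:R).
pose G i : set (R * R) :=
  [set p | (coef i).1.1 * p.1 + (coef i).1.2 * p.2 <= (coef i).2]%classic.
have G0 x y : G 0 (lattice_point R x y) <-> (2 <= x)%N.
  rewrite /G /coef /= mul0r addr0 mulN1r lerN2.
  by rewrite (ler_nat R 2 x).
have GV i x y : (0 < i < N)%N -> G i (lattice_point R x y) <-> (x <= i.+1)%N.
  case: i => // i /= hi; rewrite /G /coef /= hi /= mul0r addr0 mul1r.
  by rewrite ler_nat.
have GH j x y : G (N + j)%N (lattice_point R x y) <-> (y <= j.+1)%N.
  rewrite /G /coef /= addn_eq0 ltnNge leq_addr /= (gtn_eqF (ltnW N2)) /=.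
  by rewrite addKn mul0r add0r mul1r ler_nat.
exists (fun i : 'I_(N + M) => G i); split=> [i|].
  exists (coef i).1.1, (coef i).1.2, (coef i).2; split=> //.
  rewrite /coef; case: ifP => _; last case: ifP => _;
  by move=> [] /eqP; rewrite ?oppr_eq0 ?oner_eq0 // => _ /eqP; rewrite oner_eq0.
have sepV x y x' y' : (1 <= x)%N -> (x < x')%N -> (x' <= N.+1)%N ->
    exists i : 'I_(N + M),
      separates (G i) (lattice_point R x y) (lattice_point R x' y').
  move=> x1 xx' x'N; have hi : (x.-1 < N + M)%N by lia.
  (* Index [x.-1] cuts just after column [x]. For [x = 1] it is the reversed half-plane, which
     contains the right-hand point instead. *)
  exists (Ordinal hi) => /=; have [->|xn1] := eqVneq x 1%N.
    by right; rewrite !G0; split; lia.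
  by left; rewrite !GV; [split|..]; lia.
have sepH x y x' y' : (1 <= y)%N -> (y < y')%N -> (y' <= M.+1)%N ->
    exists i : 'I_(N + M),
      separates (G i) (lattice_point R x y) (lattice_point R x' y').
  move=> y1 yy' y'M; have hi : (N + y.-1 < N + M)%N by lia.
  by exists (Ordinal hi) => /=; left; rewrite !GH; split; lia.
split=> [p /gridP[x [y [-> hy hx]]]|].
  have h0 : (0 < N + M)%N by lia.
  have h1 : (1 < N + M)%N by lia.
  (* Column 1, missed by index 0, lies in [x <= 2], which is index 1 because [N >= 2]. *)
  have [x2|x2] := leqP 2 x; first by exists (Ordinal h0); apply/G0.
  by exists (Ordinal h1) => /=; apply/GV; [lia|exact: ltnW].
move=> p q /gridP[x [y [-> hy hx]]] /gridP[x' [y' [-> hy' hx']]] ne.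
have sym : (exists i : 'I_(N + M),
    separates (G i) (lattice_point R x' y') (lattice_point R x y)) ->
  exists i : 'I_(N + M),
    separates (G i) (lattice_point R x y) (lattice_point R x' y').
  by case=> i hi; exists i; exact: separatesC.
case: (ltngtP x x') => [xx'|xx'|ex]; first by apply: sepV; lia.
  by apply: sym; apply: sepV; lia.
case: (ltngtP y y') => [yy'|yy'|ey]; first by apply: sepH; lia.
  by apply: sym; apply: sepH; lia.
by case: ne; rewrite ex ey.
Qed.

Theorem theorem5 (R : realType) (m n : nat) (hm : (3 <= m)%N) (hn : (3 <= n)%N) :
  is_half_plane_id_number (grid R m n) (m + n - 2)%N.
Proof.
case: m hm => // M hM; case: n hn => // N hN.
have -> : (M.+1 + N.+1 - 2 = M + N)%N by lia.
split=> [|l]; last exact: grid_identification_lower_bound.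
by rewrite addnC; exact: grid_half_plane_identifiable.
Qed.
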